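(* Let $V$ be a vertex operator algebra. The following are equivalent: (a) $V$ is indecomposable as a $V$-module; (b) $\mathrm{End}(V)=Z(V)$ is a local commutative, associative algebra.
   Context: A vertex operator algebra $V$ is a (nonzero) complex vector space with vertex operators $Y(v,z)=\sum_{n\in\mathbf{Z}} v(n)z^{-n-1}$, vacuum vector $\mathbf{1}$ and conformal vector $\omega$, $Y(\omega,z)=\sum_n L(n)z^{-n-2}$, satisfying the usual axioms; $V=\bigoplus_{n\in\mathbf{Z}}V_n$ is the $L(0)$-eigenspace grading, with $\dim V_n<\infty$ and $V_n=0$ for $n$ sufficiently small. $V$ is regarded as a module over itself (adjoint module), whose submodules are the ideals of $V$. The center is $Z(V)=\{v\in V\mid L(-1)v=0\}$, a finite-dimensional commutative associative unital algebra under $ab=a(-1)b$. $\mathrm{End}(V)$ is the ring of linear maps $\varphi:V\to V$ with $\varphi Y(u,z)=Y(u,z)\varphi$ for all $u\in V$. The rings $Z(V)$ and $\mathrm{End}(V)$ are identified via the ring isomorphism $a\mapsto\varphi_a$, where $\varphi_a(v)=a(-1)v$. *)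

(* Defs.v *)
From HB Require Import structures.
From mathcomp Require Import all_boot all_order all_algebra.
From mathcomp Require Import boolp classical_sets functions reals.
From mathcomp Require Import complex.

Set Implicit Arguments.
Unset Strict Implicit.
Unset Printing Implicit Defensive.

Import GRing.Theory.
Local Open Scope ring_scope.
Local Open Scope complex_scope.

(* m (m - 1) ... (m - i + 1) / i! for an arbitrary integer m. *)
Definition binz (F : fieldType) (m : int) (i : nat) : F :=
  (\prod_(j < i) (m - j%:Z)%:~R) / i`!%:R.

(* mode u n v is u(n)v, where Y(u,z) = \sum_n u(n) z^(-n-1). *)
HB.mixin Record hasVertexOperators (R : realType) V of GRing.Lmodule R[i] V := {
  mode : V -> int -> V -> V;
  vac : V;
  omega : V
}.

#[short(type="preVoaType")]
HB.structure Definition PreVOA (R : realType) :=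
  { V of GRing.Lmodule R[i] V & hasVertexOperators R V }.

Arguments vac {R s}.
Arguments omega {R s}.

(* Y(omega,z) = \sum_n L(n) z^(-n-2), so L(n) = omega(n+1). *)
Definition virL (R : realType) (V : preVoaType R) (n : int) (v : V) : V :=
  mode omega (n + 1) v.

(* The homogeneous space V_n. *)
Definition homog (R : realType) (V : preVoaType R) (n : int) (v : V) : Prop :=
  virL 0 v = n%:~R *: v.

(* The two sums of the Jacobi identity (in Borcherds' component form, i.e. the
   coefficientwise form of the delta-function identity) are over all i >= 0
   and have only finitely many nonzero terms by truncation; an equality between
   them is an equality of all sufficiently long partial sums.
   That 1 is in V_0, omega is in V_2, and the sum of the V_n is direct follows
   from the other axioms. *)
HB.mixin Record isVOA (R : realType) V of PreVOA R V := {
  voa_nontrivial : exists v : V, v != 0;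
  mode_linearl : forall (n : int) (v : V), linear (fun u : V => mode u n v);
  mode_linearr : forall (u : V) (n : int), linear (mode u n);
  mode_truncation : forall u v : V,
    exists N : int, forall n : int, (N <= n)%R -> mode u n v = 0;
  mode_vac : forall (n : int) (v : V),
    mode (vac : V) n v = if n == -1 then v else 0;
  mode_creation : forall u : V,
    mode u (-1) vac = u /\ forall n : int, (0 <= n)%R -> mode u n vac = 0;
  mode_jacobi : forall (u v w : V) (p q r : int),
    exists N0 : nat, forall N : nat, (N0 <= N)%N ->
      \sum_(i < N) binz R[i] p i *: mode (mode u (r + i%:Z) v) (p + q - i%:Z) w
    = \sum_(i < N) ((-1) ^+ i * binz R[i] r i) *:
        (mode u (p + r - i%:Z) (mode v (q + i%:Z) w)
         - (-1) ^ r *: mode v (q + r - i%:Z) (mode u (p + i%:Z) w));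
  central_charge : R[i];
  virasoro : forall (m n : int) (v : V),
    virL m (virL n v) - virL n (virL m v) =
      (m - n)%:~R *: virL (m + n) v
      + (if m + n == 0 then (m ^+ 3 - m)%:~R / 12%:R * central_charge else 0)
          *: v;
  mode_derivative : forall (u : V) (n : int) (v : V),
    mode (virL (-1) u) n v = - n%:~R *: mode u (n - 1) v;
  homog_spanning : forall v : V, exists s : seq V,
    (forall x, x \in s -> exists n : int, homog n x) /\ v = \sum_(x <- s) x;
  homog_findim : forall n : int, exists b : seq V, forall v : V, homog n v ->
    exists c : 'I_(size b) -> R[i], v = \sum_(i < size b) c i *: b`_i;
  homog_bounded_below : exists N : int,
    forall (n : int) (v : V), (n < N)%R -> homog n v -> v = 0
}.

#[short(type="voaType")]
HB.structure Definition VOA (R : realType) :=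
  { V of PreVOA R V & isVOA R V }.

Section ModeTheory.
Variables (R : realType) (V : voaType R).
Implicit Types (a b u v w : V) (m n p q : int).

HB.instance Definition _ u n :=
  GRing.isLinear.Build R[i] V V *:%R (mode u n) (mode_linearr u n).

Lemma mode0l n v : mode (0 : V) n v = 0.
Proof.
by have := mode_linearl n v (-1) 0 0; rewrite /= scaler0 addr0 scaleN1r addNr.
Qed.

Lemma modePl k a b n v : mode (k *: a + b) n v = k *: mode a n v + mode b n v.
Proof. exact: (mode_linearl n v). Qed.

Lemma vac_neq0 : (vac : V) != 0.
Proof.
have [v v0] := @voa_nontrivial R V; apply: contra v0 => /eqP vac0.
by rewrite -[v](mode_creation v).1 vac0 linear0.
Qed.

Definition center_pred : {pred V} := fun v => virL (-1) v == 0.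

Lemma center_mode0 a n v : a \in center_pred -> n != -1 -> mode a n v = 0.
Proof.
move=> /eqP az nN; have := mode_derivative a (n + 1) v.
rewrite az mode0l addrK => /esym /eqP; rewrite scaler_eq0 oppr_eq0 intr_eq0.
by rewrite addr_eq0 (negPf nN) /= => /eqP.
Qed.

Lemma center_comm a v p q w : a \in center_pred ->
  mode a p (mode v q w) = mode v q (mode a p w).
Proof.
move=> az; have [N0 /(_ N0.+1 (leqnSn _))] := mode_jacobi a v w p q 0.
rewrite big1 => [|i _]; last first.
  by rewrite add0r (center_mode0 _ az) // mode0l scaler0.
rewrite big_ord_recl big1 => [|i _]; last first.
  rewrite /binz big_ord_recl /= !subr0 mulr0z !mul0r mulr0 scale0r //.
rewrite /binz big_ord0 /= !subr0 !addr0 fact0 invr1 !mulr1 expr0z !scale1r.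
by move=> /esym/eqP; rewrite subr_eq0 => /eqP.
Qed.

Lemma center_mulC a v : a \in center_pred -> mode a (-1) v = mode v (-1) a.
Proof.
move=> az; rewrite -{1}[v](mode_creation v).1 center_comm //.
by rewrite (mode_creation a).1.
Qed.

Lemma center_mul_closed a b : a \in center_pred -> b \in center_pred ->
  mode a (-1) b \in center_pred.
Proof.
move=> az /eqP bz; apply/eqP; rewrite /virL -center_comm //.
by move: bz; rewrite /virL => ->; rewrite linear0.
Qed.

Lemma center_vac : vac \in center_pred.
Proof. by apply/eqP; rewrite /virL (mode_creation omega).2. Qed.

Lemma center_submod_closed : submod_closed center_pred.
Proof.
split; first by rewrite unfold_in /virL linear0.
move=> k a b; rewrite !unfold_in /virL => /eqP az /eqP bz.
by rewrite mode_linearr az bz scaler0 addr0.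
Qed.

HB.instance Definition _ :=
  GRing.isSubmodClosed.Build R[i] V center_pred center_submod_closed.

Lemma center_mulA a b v : a \in center_pred -> b \in center_pred ->
  mode (mode a (-1) b) (-1) v = mode a (-1) (mode b (-1) v).
Proof.
move=> az bz; rewrite (center_mulC _ (center_mul_closed az bz)).
by rewrite (center_mulC v bz) (center_comm _ _ _ _ az).
Qed.

End ModeTheory.

Record center (R : realType) (V : voaType R) :=
  Center { center_val : V; center_valP : center_val \in @center_pred R V }.

Section Center.
Variables (R : realType) (V : voaType R).

HB.instance Definition _ := [isSub for @center_val R V].
HB.instance Definition _ := [Choice of center V by <:].
HB.instance Definition _ := [SubChoice_isSubLmodule of center V by <:].

Implicit Types a b c : center V.

Definition center_mul a b : center V :=
  Center (center_mul_closed (center_valP a) (center_valP b)).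
Definition center_one : center V := Center (@center_vac R V).

Lemma center_mulrA : associative center_mul.
Proof. by move=> a b c; apply/val_inj; rewrite /= center_mulA //; exact: valP. Qed.

Lemma center_mulrC : commutative center_mul.
Proof. by move=> a b; apply/val_inj; rewrite /= center_mulC //; exact: valP. Qed.

Lemma center_mul1r : left_id center_one center_mul.
Proof. by move=> a; apply/val_inj; rewrite /= mode_vac. Qed.

Lemma center_mulrDl : left_distributive center_mul +%R.
Proof.
move=> a b c; apply/val_inj => /=.
by have := modePl 1 (val a) (val b) (-1) (val c); rewrite !scale1r.
Qed.

Lemma center_oner_neq0 : center_one != 0.
Proof. by rewrite -val_eqE /= vac_neq0. Qed.

HB.instance Definition _ := GRing.Zmodule_isComNzRing.Build (center V)
  center_mulrA center_mulrC center_mul1r center_mulrDl center_oner_neq0.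

Lemma center_scalerAl (k : R[i]) a b : k *: (a * b) = (k *: a) * b.
Proof.
apply/val_inj => /=.
by have := modePl k (val a) 0 (-1) (val b); rewrite mode0l !addr0.
Qed.

HB.instance Definition _ :=
  GRing.Lmodule_isLalgebra.Build R[i] (center V) center_scalerAl.
HB.instance Definition _ :=
  GRing.Lalgebra_isComAlgebra.Build R[i] (center V).

End Center.

Definition voa_end_pred (R : realType) (V : voaType R) : {pred V -> V} :=
  fun f => `[< linear f /\
               forall (u : V) (n : int) (v : V),
                 f (mode u n v) = mode u n (f v) >].

Record voa_end (R : realType) (V : voaType R) := VoaEnd {
  voa_end_val :> V -> V;
  voa_end_valP : voa_end_val \in @voa_end_pred R V }.

Section End.
Variables (R : realType) (V : voaType R).

Lemma voa_end_submod_closed : submod_closed (@voa_end_pred R V).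
Proof.
split.
  apply/asboolP; split=> [k u v|u n v]; first by rewrite /= scaler0 addr0.
  by rewrite /= linear0.
move=> k f g /asboolP[fl fm] /asboolP[gl gm]; apply/asboolP; split.
  move=> l u v; rewrite !fctE /= fl gl !scalerDr !scalerA [k * l]mulrC.
  by rewrite addrACA.
by move=> u n v; rewrite !fctE /= fm gm linearP.
Qed.

HB.instance Definition _ :=
  GRing.isSubmodClosed.Build R[i] (V -> V) (@voa_end_pred R V)
    voa_end_submod_closed.
HB.instance Definition _ := [isSub for @voa_end_val R V].
HB.instance Definition _ := [Choice of voa_end V by <:].
HB.instance Definition _ := [SubChoice_isSubLmodule of voa_end V by <:].

Implicit Types f g h : voa_end V.

Lemma voa_endP f (k : R[i]) (u v : V) : f (k *: u + v) = k *: f u + f v.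
Proof. by have /asboolP[fl _] := voa_end_valP f; exact: fl. Qed.

Lemma voa_end_mode f (u : V) (n : int) (v : V) :
  f (mode u n v) = mode u n (f v).
Proof. by have /asboolP[_ fm] := voa_end_valP f; exact: fm. Qed.

Lemma voa_end_comp_subproof f g : (f : V -> V) \o g \in @voa_end_pred R V.
Proof.
by apply/asboolP; split=> [k u v|u n v] /=; rewrite ?voa_endP ?voa_end_mode.
Qed.

Lemma voa_end_id_subproof : (id : V -> V) \in @voa_end_pred R V.
Proof. exact/asboolP. Qed.

Definition voa_end_mul f g : voa_end V := VoaEnd (voa_end_comp_subproof f g).
Definition voa_end_one : voa_end V := VoaEnd voa_end_id_subproof.

Lemma voa_end_mulA : associative voa_end_mul.
Proof. by move=> f g h; apply/val_inj. Qed.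

Lemma voa_end_mul1 : left_id voa_end_one voa_end_mul.
Proof. by move=> f; apply/val_inj. Qed.

Lemma voa_end_mulr1 : right_id voa_end_one voa_end_mul.
Proof. by move=> f; apply/val_inj. Qed.

Lemma voa_end_mulDl : left_distributive voa_end_mul +%R.
Proof. by move=> f g h; apply/val_inj. Qed.

Lemma voa_end_mulDr : right_distributive voa_end_mul +%R.
Proof.
move=> f g h; apply/val_inj/funext => v /=.
by have := voa_endP f 1 (g v) (h v); rewrite !scale1r.
Qed.

Lemma voa_end_one_neq0 : voa_end_one != 0.
Proof.
apply/eqP => /(congr1 val)/(congr1 (@^~ vac)) /= /eqP.
by rewrite (negPf (vac_neq0 V)).
Qed.

HB.instance Definition _ := GRing.Zmodule_isNzRing.Build (voa_end V)
  voa_end_mulA voa_end_mul1 voa_end_mulr1 voa_end_mulDl voa_end_mulDr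
  voa_end_one_neq0.

Lemma voa_end_scalerAl (k : R[i]) f g : k *: (f * g) = (k *: f) * g.
Proof. exact/val_inj. Qed.

HB.instance Definition _ :=
  GRing.Lmodule_isLalgebra.Build R[i] (voa_end V) voa_end_scalerAl.

Lemma voa_end_scalerAr (k : R[i]) f g : k *: (f * g) = f * (k *: g).
Proof.
apply/val_inj/funext => v /=.
have f0 : f 0 = 0.
  by have := voa_endP f (-1) 0 0; rewrite scaler0 addr0 scaleN1r addNr.
by have := voa_endP f k (g v) 0; rewrite f0 !addr0.
Qed.

HB.instance Definition _ :=
  GRing.Lalgebra_isAlgebra.Build R[i] (voa_end V) voa_end_scalerAr.

Lemma center_act_subproof (a : center V) :
  mode (val a) (-1) \in @voa_end_pred R V.
Proof.
apply/asboolP; split; first exact: mode_linearr.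
by move=> u n v; rewrite center_comm //; exact: valP.
Qed.

(* The identification a |-> (v |-> a(-1)v) of Z(V) with End(V). *)
Definition center_act (a : center V) : voa_end V :=
  VoaEnd (center_act_subproof a).

Lemma center_act_linear : linear center_act.
Proof. by move=> k a b; apply/val_inj/funext => v; rewrite /= modePl. Qed.

Lemma center_act_monoid_morphism : monoid_morphism center_act.
Proof.
split; first by apply/val_inj/funext => v; rewrite /= mode_vac.
move=> a b; apply/val_inj/funext => v /=.
by rewrite center_mulA //; exact: valP.
Qed.

HB.instance Definition _ :=
  GRing.isLinear.Build R[i] (center V) (voa_end V) *:%R center_act
    center_act_linear.
HB.instance Definition _ :=
  GRing.isMonoidMorphism.Build (center V) (voa_end V) center_act
    center_act_monoid_morphism.

End End.

(* Submodules of the adjoint module, i.e. ideals of V. *)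
Definition voa_ideal (R : realType) (V : voaType R) (I : set V) : Prop :=
  submod_closed [in I] /\
  forall (u : V) (n : int) (v : V), I v -> I (mode u n v).

(* V is nonzero by voa_nontrivial. *)
Definition voa_indecomposable (R : realType) (V : voaType R) : Prop :=
  forall I J : set V, voa_ideal I -> voa_ideal J ->
    (I `&` J = [set 0])%classic ->
    (forall v : V, exists2 x : V, I x & exists2 y : V, J y & v = x + y) ->
    (I = [set 0] \/ J = [set 0])%classic.

(* The library's idealr_closed includes properness: 1 is not in M. *)
Definition maximal_ideal (A : comNzRingType) (M : set A) : Prop :=
  idealr_closed [in M] /\
  forall J : set A, idealr_closed [in J] -> (M `<=` J)%classic -> J = M.

Definition local_ring (A : comNzRingType) : Prop :=
  exists! M : set A, maximal_ideal M.

(* Main.v *)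
Require Import Defs.
From mathcomp Require Import all_boot all_algebra reals.
From mathcomp Require Import boolp classical_sets complex.

(** Since 1 generates the adjoint module, an endomorphism is determined by the
    image of 1, which is central; hence End(V) = Z(V).  A decomposition of V
    into two ideals splits 1 into two orthogonal central idempotents, and
    conversely a central idempotent e gives V = eV + (1 - e)V, so V is
    indecomposable iff 0 and 1 are the only idempotents of Z(V).  As Z(V) lies
    in V_0, it is finite-dimensional, so each a in Z(V) satisfies
    a^n = a^(2n) c for some n and c.  Then a^n c is idempotent, which makes a
    or 1 - a invertible if the idempotents are trivial, and Z(V) is local. *)

Set Implicit Arguments.
Unset Strict Implicit.
Unset Printing Implicit Defensive.

Import GRing.Theory.
Local Open Scope ring_scope.

(** The coefficient matrix has one more row than columns, so its left kernel is nonzero. *)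
Lemma dependent_of_span (K : fieldType) (V : lmodType K) (b : seq V)
    (x : 'I_(size b).+1 -> V) :
  (forall i, exists c : 'I_(size b) -> K, x i = \sum_j c j *: b`_j) ->
  exists2 c : 'rV[K]_(size b).+1, c != 0 & \sum_i c 0 i *: x i = 0.
Proof.
move=> /choice[m xE]; pose M := \matrix_(i, j) m i j.
have kM0 : kermx M != 0.
  rewrite kermx_eq0 /row_free neq_ltn; apply/orP; left.
  exact: leq_ltn_trans (rank_leq_col M) (ltnSn _).
have [c /sub_kermxP cM0 c0] := rowV0Pn kM0; exists c => //.
under eq_bigr => i _ do rewrite xE scaler_sumr.
rewrite exchange_big big1 //= => j _.
under eq_bigr => i _ do rewrite scalerA.
rewrite -scaler_suml; have /rowP/(_ j) := cM0; rewrite !mxE.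
by under eq_bigr => i _ do rewrite mxE; move=> ->; rewrite scale0r.
Qed.

(** * Powers and idempotents in a finite-dimensional commutative algebra *)

Section FiniteDimensionalAlgebra.
Variables (K : fieldType) (A : comAlgType K) (d : nat).
Hypothesis dependent : forall x : 'I_d.+1 -> A,
  exists2 c : 'rV[K]_d.+1, c != 0 & \sum_i c 0 i *: x i = 0.

(** A linear relation among the powers of [a] is solved for its term of lowest degree; all other
    terms are multiples of the next power. *)
Lemma power_eq_succ_mul (a : A) : exists n y, a ^+ n = a ^+ n.+1 * y.
Proof.
have [c /rV0Pn[k ck] ca] := dependent (fun i => a ^+ i).
case: (@arg_minnP _ k (fun i => c 0 i != 0) (fun i => i : nat) ck).
move=> i0 c0 i0_min.
exists i0, (- (c 0 i0)^-1 *: \sum_(i | i != i0) c 0 i *: a ^+ (i - i0.+1)).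
apply: (scalerI c0); rewrite -scalerAr scaleNr scalerN scalerA divff // scale1r.
move: ca; rewrite (bigD1 i0) //= => /eqP; rewrite addr_eq0 => /eqP ->.
congr (- _); rewrite mulr_sumr; apply: eq_bigr => i ii0; rewrite -scalerAr.
(* Below [i0] the truncated exponent [i - i0.+1] is meaningless, but there the coefficient vanishes
   by minimality. *)
have [-> | ci] := eqVneq (c 0 i) 0; first by rewrite !scale0r.
by rewrite -exprD subnKC // ltn_neqAle eq_sym ii0 i0_min.
Qed.

(** Iterating the previous relation raises the exponent at will. The exponent [n.+1] is positive, so
    that [a] is a unit once [a ^+ n.+1 * y = 1]. *)
Lemma power_eq_double_mul (a : A) : exists n y,
  a ^+ n.+1 = a ^+ (n.+1 + n.+1) * y.
Proof.
have [n [y an]] := power_eq_succ_mul a.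
have anm m : a ^+ n = a ^+ (n + m) * y ^+ m.
  elim: m => [|m IHm]; first by rewrite addn0 mulr1.
  by rewrite {1}IHm addnS -addSn !exprD {1}an (exprS y) mulrA [_ * y * _]mulrAC.
by exists n, (y ^+ n.+1); rewrite exprS {1}(anm n.+1) mulrA -exprS.
Qed.

Lemma unit_dichotomy :
  (forall e : A, e * e = e -> e = 0 \/ e = 1) ->
  forall a : A, (exists y, a * y = 1) \/ (exists y, (1 - a) * y = 1).
Proof.
move=> triv a; have [n [y an]] := power_eq_double_mul a.
have [|e0|e1] := triv (a ^+ n.+1 * y).
- by rewrite mulrA [_ * a ^+ _]mulrAC -exprD -an.
- right; have an0 : a ^+ n.+1 = 0 by rewrite an exprD -mulrA e0 mulr0.
  (* As [a] is nilpotent, the finite geometric series inverts [1 - a]. *)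
  exists (\sum_(i < n.+1) a ^+ i).
  by rewrite -opprB mulNr -subrX1 an0 sub0r opprK.
- by left; exists (a ^+ n * y); rewrite mulrA -exprS.
Qed.

End FiniteDimensionalAlgebra.

(** * Local rings, maximal ideals and idempotents *)

Section LocalRing.
Variable A : comNzRingType.

(** The non-units form an ideal, and it contains every proper ideal. *)
Lemma local_of_unit_dichotomy :
  (forall a : A, (exists y, a * y = 1) \/ (exists y, (1 - a) * y = 1)) ->
  local_ring A.
Proof.
move=> dich; pose N : set A := [set x | ~ exists y, x * y = 1]%classic.
have sub_N (J : set A) : idealr_closed [in J] -> (J `<=` N)%classic.
  move=> [J0 /negP J1 JD] x Jx [y xy]; apply: J1.
  by rewrite -xy mulrC -[_ * _]addr0; apply: JD => //; apply/mem_set.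
have NI : idealr_closed [in N].
  split.
  - by apply/mem_set => -[y]; rewrite mul0r => /esym/eqP; rewrite oner_eq0.
  - by apply/negP => /set_mem; apply; exists 1; rewrite mulr1.
  - move=> a u v /set_mem Nu /set_mem Nv; apply/mem_set => -[y uvy].
    (* From [(a * u + v) * y = 1] it follows that [1 - a * u * y = v * y], so [u] or [v] would be a
       unit. *)
    have [[z]|[z]] := dich (a * u * y).
      by rewrite [a * u]mulrC -!mulrA => uz; apply: Nu; exists (a * (y * z)).
    rewrite -{1}uvy [(_ + v) * y]mulrDl addrAC subrr add0r => vz.
    by apply: Nv; exists (y * z); rewrite mulrA.
exists N; split; last first.
  by move=> M [MI Mmax]; apply: Mmax => //; apply: sub_N.
by split=> // J JI NJ; apply/seteqP; split=> //; apply: sub_N.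
Qed.

Lemma sub_maximal_ideal (I : set A) : idealr_closed [in I] ->
  exists2 M : set A, maximal_ideal M & (I `<=` M)%classic.
Proof.
move=> II.
(* Ideals of the form I `|` X, so that Zorn's empty chain is no obstacle. *)
pose P (X : set A) := idealr_closed [in (I `|` X)%classic].
have [F FP Ftot|M [PM Mmax]] := @Zorn_bigcup A P.
  have [X0|/set0P[X1 FX1]] := eqVneq F set0.
    by rewrite /P X0 bigcup_set0 setU0.
  have cover x : (I `|` \bigcup_(X in F) X)%classic x ->
      exists2 X, F X & (I `|` X)%classic x.
    by case=> [Ix|[X FX Xx]]; [exists X1 => //; left | exists X => //; right].
  have subcover X : F X -> (I `|` X `<=` I `|` \bigcup_(Y in F) Y)%classic.
    by move=> FX x [Ix|Xx]; [left | right; exists X].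
  split.
  - by apply/mem_set; left; apply/set_mem; case: II.
  - apply/negP => /set_mem/cover[X FX /mem_set X1'].
    by have [_ /negP] := FP X FX.
  - move=> a u v /set_mem/cover[X FX Xu] /set_mem/cover[Y FY Yv].
    have [Z FZ [Zu Zv]] : exists2 Z, F Z &
        (I `|` Z)%classic u /\ (I `|` Z)%classic v.
      have [XY|YX] := Ftot X Y FX FY.
        by exists Y => //; split=> //; apply: setUS Xu.
      by exists X => //; split=> //; apply: setUS Yv.
    have [_ _ ZD] := FP Z FZ.
    by apply/mem_set/(subcover Z FZ)/set_mem/ZD; apply/mem_set.
exists (I `|` M)%classic; last by move=> x; left.
split=> // J JI IMJ; apply/seteqP; split=> // x Jx; right.
apply: contrapT => Mx; apply: (Mmax J).
  by split=> [y My|/(_ _ Jx)//]; apply: IMJ; right.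
suff IJ : (I `|` J = J)%classic by rewrite /P IJ.
by apply/setUidPr => y Iy; apply: IMJ; left.
Qed.

Lemma principal_ideal_closed (e : A) : (forall y, e * y <> 1) ->
  idealr_closed [in [set e * y | y in setT]%classic].
Proof.
move=> eN1; split.
- by apply/mem_set; exists 0; rewrite ?mulr0.
- by apply/negP => /set_mem[y _ /eN1].
- move=> a u v /set_mem[x _ <-] /set_mem[y _ <-]; apply/mem_set.
  by exists (a * x + y) => //; rewrite mulrDr mulrCA.
Qed.

(** If [e] is neither 0 nor 1, then [e] and [1 - e] are both non-units, so both lie in the maximal
    ideal, and so does their sum 1. *)
Lemma local_idempotent (e : A) : local_ring A -> e * e = e -> e = 0 \/ e = 1.
Proof.
move=> [M [[[M0 /negP M1 MD] _] Muniq]] ee.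
have in_M (f : A) : f * f = f -> f <> 1 -> M f.
  (* An invertible idempotent equals 1. *)
  move=> ff f1; have fN1 y : f * y <> 1.
    by move=> fy; apply: f1; rewrite -[f]mulr1 -fy mulrA ff.
  have [M' M'max fM'] := sub_maximal_ideal (principal_ideal_closed fN1).
  by rewrite (Muniq _ M'max); apply: fM'; exists 1; rewrite ?mulr1.
have [->|/eqP e0] := eqVneq e 0; first by left.
have [->|/eqP e1] := eqVneq e 1; first by right.
case: M1; rewrite -[1](subrK e) -[1 - e]mul1r; apply: MD; apply/mem_set.
  apply: in_M.
    by rewrite mulrBr mulrBl mulr1 mul1r mulrBl mul1r ee subrr subr0.
  by move=> /eqP; rewrite -subr_eq0 addrC addKr oppr_eq0 => /eqP.
exact: in_M.
Qed.

End LocalRing.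

(** * The center and its action on V *)

Section VOA.
Variables (R : realType) (V : voaType R).

(** L(0)a = L(0)a(-1)1 = a(-1)L(0)1 = 0. *)
Lemma center_homog0 (a : V) : a \in @center_pred R V -> homog 0 a.
Proof.
move=> az; rewrite /homog scale0r /virL.
rewrite -[X in mode _ _ X](mode_creation a).1.
by rewrite -center_comm // (mode_creation omega).2 // linear0.
Qed.

Lemma center_dependent : exists d, forall x : 'I_d.+1 -> center V,
  exists2 c : 'rV[R[i]%C]_d.+1, c != 0 & \sum_i c 0 i *: x i = 0.
Proof.
have [b bP] := @homog_findim R V 0.
exists (size b) => x.
have [i|c c0 cx] := @dependent_of_span _ _ b (fun i => val (x i)).
  by apply: bP; apply: center_homog0; apply: valP.
by exists c => //; apply/val_inj; rewrite raddf_sum.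
Qed.

Lemma voa_endD (f : voa_end V) (u v : V) : f (u + v) = f u + f v.
Proof. by have := voa_endP f 1 u v; rewrite !scale1r. Qed.

Lemma voa_end0 (f : voa_end V) : f 0 = 0.
Proof. by apply: (addrI (f 0)); rewrite -voa_endD !addr0. Qed.

Lemma center_act_vac (a : center V) : center_act a vac = val a.
Proof. exact: (mode_creation (val a)).1. Qed.

Lemma center_act_bij : bijective (@center_act R V).
Proof.
have fvac (f : voa_end V) : f vac \in @center_pred R V.
  by apply/eqP; rewrite /virL -voa_end_mode (mode_creation omega).2 // voa_end0.
exists (fun f => Center (fvac f)) => [a|f]; apply/val_inj => /=.
  exact: center_act_vac.
(* f(1)(-1)v = v(-1)f(1) = f(v(-1)1) = f(v). *)
apply/funext => v; rewrite center_mulC // -voa_end_mode.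
by rewrite (mode_creation v).1.
Qed.

(** * Ideals of V and central idempotents *)

Lemma voa_ideal_image (f : voa_end V) : voa_ideal [set f v | v in setT]%classic.
Proof.
split; last first.
  by move=> u n _ [v _ <-]; exists (mode u n v); rewrite ?voa_end_mode.
split; first by apply/mem_set; exists 0; rewrite ?voa_end0.
move=> k _ _ /set_mem[x _ <-] /set_mem[y _ <-]; apply/mem_set.
by exists (k *: x + y); rewrite ?voa_endP.
Qed.

Lemma voa_ideal_vac (I : set V) : voa_ideal I -> I vac -> forall v, I v.
Proof. by move=> [_ IM] Ivac v; rewrite -(mode_creation v).1; apply: IM. Qed.

Lemma voa_indecomposable_idempotent (e : center V) :
  voa_indecomposable V -> e * e = e -> e = 0 \/ e = 1.
Proof.
move=> indec ee; pose E := center_act e.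
have EEv v : E (E v) = E v.
  by rewrite -[E (E v)]/((E * E : voa_end V) v) -rmorphM ee.
have image0 (a : center V) :
    [set center_act a v | v in setT]%classic = [set 0]%classic -> a = 0.
  move=> a0; apply/val_inj; rewrite -center_act_vac.
  have : [set center_act a v | v in setT]%classic (center_act a vac).
    by exists vac.
  by rewrite a0.
have E1E (v : V) : E (center_act (1 - e) v) = 0.
  rewrite -[E _]/((E * center_act (1 - e) : voa_end V) v).
  by rewrite -rmorphM mulrBr mulr1 ee subrr rmorph0.
have [|v|/image0|/image0 /eqP] := indec _ _ (voa_ideal_image E)
    (voa_ideal_image (center_act (1 - e))).
- apply/seteqP; split=> [_ [[v _ <-] [w _ wv]]|_ ->]; last first.
    by split; exists 0 => //; apply: voa_end0.
  suff: E v = 0 by [].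
  by rewrite -EEv -wv E1E.
- exists (E v); first by exists v.
  exists (center_act (1 - e) v); first by exists v.
  rewrite -[RHS]/((E + center_act (1 - e) : voa_end V) v).
  by rewrite -rmorphD addrC subrK rmorph1.
- by left.
- by rewrite subr_eq0 => /eqP <-; right.
Qed.

Lemma indecomposable_of_idempotent :
  (forall e : center V, e * e = e -> e = 0 \/ e = 1) -> voa_indecomposable V.
Proof.
move=> triv I J II JI IJ0 IJ.
have IJ_0 v : I v -> J v -> v = 0.
  by move=> Iv Jv; have : (I `&` J)%classic v by []; rewrite IJ0.
have [e Ie [f Jf ef]] := IJ vac.
have ef0 : virL (-1) e + virL (-1) f = 0.
  by have := (mode_creation (omega : V)).2 0 isT; rewrite ef linearD.
(* L(-1)e = -L(-1)f lies in both [I] and [J], hence is 0. *)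
have ez : e \in @center_pred R V.
  apply/eqP; apply: IJ_0; first exact: II.2.
  have -> : virL (-1) e = (-1) *: virL (-1) f + 0.
    by apply/eqP; rewrite addr0 scaleN1r -addr_eq0 ef0.
  have [[J0 JD] JM] := JI.
  by apply/set_mem/JD => //; apply/mem_set/JM.
(* By centrality e(-1)f = f(-1)e, which again lies in both ideals; so e = e(-1)(e + f) = e(-1)e. *)
have efm : mode e (-1) f = 0.
  by apply: IJ_0; [rewrite center_mulC //; apply: II.2 | apply: JI.2].
have [|e0|e1] := triv (Center ez).
- apply/val_inj => /=; rewrite -[RHS](mode_creation e).1 ef.
  by rewrite linearD /= efm addr0.
(* Now [f] is the vacuum, so [J] is all of V and [I] is zero. *)
- left; have {}e0 : e = 0 by have := congr1 val e0.
  apply/seteqP; split=> [v Iv|_ ->]; last by apply/set_mem; case: II => -[].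
  by apply: IJ_0 => //; apply: voa_ideal_vac => //; rewrite ef e0 add0r.
- right; have {}e1 : e = vac by have := congr1 val e1.
  apply/seteqP; split=> [v Jv|_ ->]; last by apply/set_mem; case: JI => -[].
  by apply: IJ_0 => //; apply: voa_ideal_vac => //; rewrite -e1.
Qed.

End VOA.

Theorem proposition2p6 (R : realType) (V : voaType R) :
  voa_indecomposable V <->
  bijective (@center_act R V) /\ local_ring (center V).
Proof.
split=> [indec|[_ loc]].
  split; first exact: center_act_bij.
  have [d dep] := center_dependent V.
  apply: local_of_unit_dichotomy; apply: (unit_dichotomy dep) => e.
  exact: voa_indecomposable_idempotent.
by apply: indecomposable_of_idempotent => e; apply: local_idempotent.
Qed.
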